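(* For graphs $G$ with at least one edge and with $n$ vertices, as $n\to\infty$, $$\chi^\star_\ell(G) \le \frac{(5+o(1)) \log n}{\log\big(\chi_f(G)/(\chi_f(G)-1)\big)}\le (5+o(1))\,\chi_f(G)\log n .$$ Moreover, if $\chi_f(G)$ is bounded as $n\to\infty$, then the leading constant $5$ can be improved to $1$; that is, for every constant $M$, the graphs $G$ with at least one edge, with $n$ vertices and with $\chi_f(G)\le M$ satisfy, as $n\to\infty$, $$\chi^\star_\ell(G) \le \frac{(1+o(1)) \log n}{\log\big(\chi_f(G)/(\chi_f(G)-1)\big)}\le (1+o(1))\,\chi_f(G)\log n .$$
   Context: Graphs are finite and simple; $\log$ is the natural logarithm. The $o(1)$ terms tend to $0$ as $n\to\infty$ and depend only on $n$ (and, in the second part, on the constant $M$): e.g. the first bound says that for every $\varepsilon>0$ there is $n_0$ such that the inequality holds with $5+\varepsilon$ in place of $5+o(1)$ for every graph with at least one edge and $n\ge n_0$ vertices. The fractional chromatic number $\chi_f(G)$ is the least real $k$ such that there is a probability distribution over the independent sets of $G$ with $\mathbb{P}(v\in \mathbf{S})\ge 1/k$ for each $v\in V(G)$, where $\mathbf{S}$ is a random independent set drawn according to the distribution. A list-assignment $L$ of $G$ maps each vertex $v\in V(G)$ to a set $L(v)\subseteq\mathbb{N}$ of colours; it is a $k$-list-assignment if $|L(v)|=k$ for every $v$. A proper $L$-colouring is a map $c:V(G)\to\mathbb{N}$ with $c(v)\in L(v)$ for all $v$ and $c(u)\neq c(v)$ for every edge $uv$. A proper $L$-packing of $G$ of size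 $k$ is a collection of $k$ proper $L$-colourings $c_1,\dots,c_k$ that are mutually disjoint, i.e. $c_i(v)\neq c_j(v)$ for all $i\neq j$ and all $v\in V(G)$. The list packing number $\chi^\star_\ell(G)$ is the least $k$ such that $G$ admits a proper $L$-packing of size $k$ for every $k$-list-assignment $L$ of $G$. *)

(* Defs.v *)
From HB Require Import structures.
From mathcomp Require Import all_boot all_order all_algebra all_fingroup.
From mathcomp Require Import finmap.
From mathcomp Require Import boolp classical_sets reals exp.

Set Implicit Arguments.
Unset Strict Implicit.
Unset Printing Implicit Defensive.

Import Order.TTheory GRing.Theory Num.Theory.

Local Open Scope ring_scope.

Record sgraph := SGraph {
  vertex :> finType;
  edge : rel vertex;
  edge_sym : symmetric edge;
  edge_irr : irreflexive edge }.

Definition has_edge (G : sgraph) : Prop := exists u v : G, edge u v.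

Definition independent (G : sgraph) (S : {set G}) : bool :=
  [forall u in S, forall v in S, ~~ edge u v].

(* [p] is only read on independent sets, where it is a probability mass
   function. *)
Definition indep_distr (R : realType) (G : sgraph) (p : {set G} -> R) : Prop :=
  (forall S, independent S -> 0 <= p S) /\ \sum_(S | independent S) p S = 1.

Definition pr_mem (R : realType) (G : sgraph) (p : {set G} -> R) (v : G) : R :=
  \sum_(S | independent S && (v \in S)) p S.

(* The condition [0 < k] is needed: for [k <= 0] the inequality
   [k^-1 <= pr_mem p v] holds trivially. The infimum is attained, because the
   distributions form a compact set. *)
Definition frac_chromatic_number (R : realType) (G : sgraph) : R :=
  inf [set k : R | 0 < k /\
         exists p : {set G} -> R,
           indep_distr p /\ forall v : G, k^-1 <= pr_mem p v]%classic.

Definition list_assignment (G : sgraph) (k : nat) (L : G -> {fset nat}) : Prop :=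
  forall v, #|` L v|%fset = k.

Definition proper_list_colouring (G : sgraph) (L : G -> {fset nat})
    (c : G -> nat) : Prop :=
  (forall v, c v \in L v) /\ (forall u v, edge u v -> c u <> c v).

Definition proper_list_packing (G : sgraph) (L : G -> {fset nat}) (k : nat)
    (c : 'I_k -> G -> nat) : Prop :=
  (forall i, proper_list_colouring L (c i)) /\
  (forall i j, i <> j -> forall v, c i v <> c j v).

(* [0 < k] excludes the degenerate case of empty lists and empty packings. *)
Definition list_packable (G : sgraph) (k : nat) : Prop :=
  (0 < k)%N /\
  forall L : G -> {fset nat}, list_assignment k L ->
    exists c : 'I_k -> G -> nat, proper_list_packing L c.

Lemma perm_avoiding (k d : nat) (forb : rel 'I_k) :
  (d + d < k)%N ->
  (forall i, (#|[set j | forb i j]| <= d)%N) ->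
  (forall j, (#|[set i | forb i j]| <= d)%N) ->
  exists s : {perm 'I_k}, forall i, ~~ forb i (s i).
Proof.
move=> dk hrow hcol.
pose N (s : {perm 'I_k}) := [set i | forb i (s i)].
have [s _ smin] := @arg_minnP {perm 'I_k} 1%g xpredT (fun s => #|N s|) isT.
exists s => i; apply/negP => fi.
pose B := [set j | forb i (s j)] :|: [set j | forb j (s i)].
have cB : (#|B| < #|[set: 'I_k]|)%N.
  rewrite cardsT card_ord (leq_ltn_trans _ dk)// (leq_trans (leq_card_setU _ _))//.
  apply: leq_add; last exact: hcol.
  rewrite (leq_trans _ (hrow i))//.
  rewrite -(card_imset [set j | forb i (s j)] (@perm_inj _ s)).
  by apply/subset_leq_card/fintype.subsetP => x /imsetP[y]; rewrite !inE => fy ->.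
have /fintype.subsetPn[j _] : ~~ ([set: 'I_k] \subset B).
  by apply: contraL cB => /subset_leq_card; rewrite -leqNgt.
rewrite !inE negb_or => /andP[nij nji].
have := smin (tperm i j * s)%g isT; apply/negP; rewrite -ltnNge.
apply: proper_card; apply/properP; split; last first.
  by exists i; rewrite !inE// permM tpermL.
apply/fintype.subsetP => x; rewrite !inE permM.
case: tpermP => [->|->|_ _]//; by [rewrite (negPf nij)|rewrite (negPf nji)].
Qed.

Lemma card_functional_le (I J : finType) (r : I -> J -> bool) :
  (forall u x y, r u x -> r u y -> x = y) ->
  (#|[set x | [exists u, r u x]]| <= #|I|)%N.
Proof.
move=> rfun.
have someI : injective (@Some I) by move=> x y [].
pose f (x : J) := [pick u | r u x].
have fP x : x \in [set x | [exists u, r u x]] -> exists2 u, f x = Some u & r u x.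
  rewrite inE /f => /existsP[u ru]; case: pickP => [w rw|/(_ u)]; first by exists w.
  by rewrite ru.
have finj : {in [set x | [exists u, r u x]] &, injective f}.
  by move=> x y /fP[u -> ru] /fP[w -> rw] [uw]; apply: (rfun u) => //; rewrite uw.
rewrite -(card_in_imset finj) -(card_imset I someI).
apply/subset_leq_card/fintype.subsetP => o /imsetP[x /fP[u -> _] ->].
by rewrite imset_f.
Qed.

(* Extend the packing one vertex at a time: a new vertex sees at most [#|G|]
   conflicts per colouring and per colour. *)
Lemma list_packable_ex (G : sgraph) : exists k, list_packable G k.
Proof.
pose n := #|G|; exists (n + n).+1; split=> // L Lk.
suff ext m : (m <= n)%N -> exists A : {set G}, #|A| = m /\
    exists c : 'I_(n + n).+1 -> G -> nat,
      [/\ forall i v, v \in A -> c i v \in L v,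
          forall i u v, u \in A -> v \in A -> edge u v -> c i u <> c i v &
          forall i j, i <> j -> forall v, v \in A -> c i v <> c j v].
  have [A [cA [c [c1 c2 c3]]]] := ext n (leqnn _).
  have inA v : v \in A.
    suff -> : A = [set: G] by rewrite inE.
    by apply/eqP; rewrite eqEcard finset.subsetT cardsT cA leqnn.
  exists c; split=> [i|i j ij v]; last exact: c3.
  by split=> [v|u v]; [exact: c1 | exact: c2].
elim: m => [_|m IH mn].
  exists finset.set0; rewrite cards0; split=> //; exists (fun _ _ => 0%N).
  by split=> [i v|i u v|i j ij v]; rewrite inE.
have [A [cA [c [c1 c2 c3]]]] := IH (ltnW mn).
have /fintype.subsetPn[v _ vA] : ~~ ([set: G] \subset A).
  by apply: contraL mn => /subset_leq_card; rewrite cardsT cA -leqNgt.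
pose col (j : 'I_(n + n).+1) := nth 0%N (enum_fset (L v)) j.
have szL : size (enum_fset (L v)) = (n + n).+1 by rewrite -(Lk v).
have colL j : col j \in L v by apply: mem_nth; rewrite szL.
have col_inj : injective col.
  move=> x y /eqP; rewrite nth_uniq ?szL ?fset_uniq// => /eqP; exact: val_inj.
pose forb : rel 'I_(n + n).+1 :=
  fun i j => [exists u, (u \in A) && (c i u == col j)].
have [||s sP] := @perm_avoiding _ n forb (ltnSn _).
- move=> i; apply: card_functional_le => u x y /andP[_ /eqP ex] /andP[_ /eqP ey].
  by apply: col_inj; rewrite -ex -ey.
- move=> j; apply: card_functional_le => u x y /andP[uA /eqP ex] /andP[_ /eqP ey].
  by apply: contrapT => /c3 /(_ u uA); rewrite ex ey.
have sP' i u : u \in A -> c i u <> col (s i).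
  by move=> uA eq; case/negP: (sP i); apply/existsP; exists u; rewrite uA eq eqxx.
exists (v |: A); split; first by rewrite cardsU1 vA cA.
exists (fun i u => if u == v then col (s i) else c i u); split.
- by move=> i u; rewrite !inE; case: eqP => [-> _|_ /= uA]; [exact: colL|exact: c1].
- move=> i u w; rewrite !inE; case: eqP => [->|_] /=; case: eqP => [->|_] //=.
  + by rewrite edge_irr.
  + by move=> _ wA _ /esym; exact: sP'.
  + by move=> uA _ _; exact: sP'.
  + exact: c2.
- move=> i j ij u; rewrite !inE; case: eqP => [_ _|_ /= uA]; last exact: c3.
  by move/col_inj/perm_inj.
Qed.

Lemma list_packableb_ex (G : sgraph) : exists k, `[< list_packable G k >].
Proof. by have [k kP] := list_packable_ex G; exists k; apply/asboolP. Qed.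

Definition list_packing_number (G : sgraph) : nat :=
  ex_minn (list_packableb_ex G).

(* Main.v *)
Require Import Defs.
From mathcomp Require Import all_boot all_order all_algebra all_fingroup.
From mathcomp Require Import finmap ring lra zify.
From mathcomp Require Import boolp classical_sets reals sequences exp.

Set Implicit Arguments.
Unset Strict Implicit.
Unset Printing Implicit Defensive.

Import Order.TTheory GRing.Theory Num.Theory.
Local Open Scope ring_scope.

(** Fix lists of size [k], with chif the fractional chromatic number and [n] the
    order of the graph. For every colour [x] and every index [i < k], draw an
    independent set [f (x, i)], all draws being independent and each vertex
    being missed with probability at most [q], roughly [1 - 1 / chif].
    Allow the [i]-th colouring to give colour [x] to [v] only when [v] lies in
    [f (x, i)]: then every colouring is proper, whatever is chosen among the
    allowed colours. At a fixed vertex, a disjoint choice for the [k] colourings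
    is a perfect matching in a random bipartite graph between the [k] indices
    and the [k] colours of its list, in which each pair is absent with
    probability at most [q].

    By Hall's theorem ([hall], [perm_of_no_empty_rectangle]) such a matching
    exists unless some rectangle [X * Y] with [#|X| + #|Y| = k + 1] has no
    present pair, an event of probability at most [q ^ (#|X| * #|Y|)]. The union
    bound over all vertices and rectangles ([exists_choice_avoiding],
    [rectangle_sum]) leaves at most [16 n k^3 q^(k+1)]; when it is less than 1,
    all vertices can be matched simultaneously ([list_packable_of_distr]).

    It remains to choose [k]. Write [lam] for [ln (chif / (chif - 1))] and take
    [k] to be the integer part of [c ln n / lam], so that [q ^ (k+1)] is about
    [n ^ -c]. As [1 / lam <= chif <= n], in general [k] is at most
    [c n ln n] and [n k^3] is of order [n^4] up to logarithms, while the
    summability of the binomial factors asks for [k^4 q^(k+1)] to be small, again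
    of order [n ^ (4 - c)]; both are controlled by [c = 5 + eps]. If [chif] is
    bounded then [k] is logarithmic in [n] and [c = 1 + eps] is enough. *)

(** * Matchings in finite bipartite graphs *)

Section Hall.
Local Open Scope nat_scope.
Variables (I J : finType).
Implicit Types (A : {ffun I -> {set J}}) (P Q : {set I}).

Definition hall_condition A := forall P, #|P| <= #|\bigcup_(i in P) A i|.

Definition remove_from A i x : {ffun I -> {set J}} :=
  [ffun j => if j == i then A i :\ x else A j].

(** Rado's exchange argument: a set [P] blocking the removal of [x] and a set [Q]
    blocking the removal of [y] have neighbourhoods whose union contains the
    neighbourhood of [i |: (P :|: Q)] (because [x != y]) and whose intersection
    contains that of [P :&: Q]. Submodularity of the cardinality then contradicts
    Hall's condition for one of these two sets. *)
Lemma hall_remove A i x y : hall_condition A -> x != y -> x \in A i -> y \in A i ->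
  hall_condition (remove_from A i x) \/ hall_condition (remove_from A i y).
Proof.
move=> hA xy xi yi.
have bad z : ~ hall_condition (remove_from A i z) ->
    exists2 P : {set I}, i \notin P & #|(A i :\ z) :|: \bigcup_(j in P) A j| <= #|P|.
  move=> nh.
  have [|P] := boolP [exists P : {set I}, #|\bigcup_(j in P) remove_from A i z j| < #|P|].
    move=> /existsP[P]; have [iP|iP] := boolP (i \in P) => ltP.
      exists (P :\ i); first by rewrite !inE eqxx.
      move: ltP; rewrite (cardsD1 i P) iP add1n ltnS.
      rewrite (big_setD1 i iP)/= ffunE eqxx.
      rewrite (eq_bigr A)// => j; rewrite !inE ffunE => /andP[/negPf-> //].
    suff : #|\bigcup_(j in P) A j| < #|P| by rewrite ltnNge hA.
    rewrite (eq_bigr (remove_from A i z))// => j jP; rewrite ffunE.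
    by case: eqP => // ji; rewrite -ji jP in iP.
  by case: nh => P'; move: P; rewrite negb_exists => /forallP/(_ P'); rewrite -leqNgt.
have hdec z : hall_condition (remove_from A i z) \/
    ~ hall_condition (remove_from A i z).
  have [/forallP h|/forallPn[P /negP h]] :=
    boolP [forall P : {set I}, #|P| <= #|\bigcup_(j in P) remove_from A i z j|].
    by left.
  by right => /(_ P).
case: (hdec x) => [|/bad[P iP leP]]; first by left.
case: (hdec y) => [|/bad[Q iQ leQ]]; first by right.
exfalso; set X := _ :|: _ in leP; set Y := _ :|: _ in leQ.
(* A point of [A i] other than [x] is in [X]; [x] itself is in [Y]. *)
have XY : \bigcup_(j in i |: (P :|: Q)) A j \subset X :|: Y.
  apply/bigcupsP => j; rewrite !inE => /or3P[/eqP->|jP|jQ]; apply/fintype.subsetP => z zj.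
  - by rewrite !inE zj !andbT; case: (eqVneq z x) => // ->; rewrite xy orbT.
  - by rewrite !inE; apply/orP; left; apply/orP; right; apply/bigcupP; exists j.
  - by rewrite !inE; apply/orP; right; apply/orP; right; apply/bigcupP; exists j.
have XIY : \bigcup_(j in P :&: Q) A j \subset X :&: Y.
  apply/bigcupsP => j; rewrite !inE => /andP[jP jQ]; apply/fintype.subsetP => z zj.
  by rewrite !inE; apply/andP; split; apply/orP; right; apply/bigcupP; exists j.
have := leq_add leP leQ; rewrite -cardsUI -(cardsUI P Q) leqNgt => /negP; apply.
rewrite -addSn leq_add//; last by rewrite (leq_trans (hA _))// subset_leq_card.
apply: leq_trans (subset_leq_card XY); rewrite (leq_trans _ (hA _))//.
by rewrite cardsU1 !inE negb_or iP iQ.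
Qed.

(** Hall's marriage theorem. Edges are deleted with [hall_remove] until every
    [A i] is a singleton; Hall's condition on pairs then says that the
    singletons are distinct. *)
Theorem hall A : hall_condition A ->
  exists2 f : I -> J, injective f & forall i, f i \in A i.
Proof.
have [m] := ubnP (\sum_i #|A i|); elim: m => // m IH in A * => ltm hA.
have [/existsP[i /card_gt1P[x [y [xi yi xy]]]]|] :=
    boolP [exists i, 1 < #|A i|].
  have rec z : z \in A i -> hall_condition (remove_from A i z) ->
      exists2 f : I -> J, injective f & forall i, f i \in A i.
    move=> zi /IH[|f finj fA].
      rewrite -ltnS (leq_trans _ ltm)// ltnS [X in _ < X](bigD1 i)//= (bigD1 i)//=.
      rewrite ffunE eqxx (cardsD1 z (A i)) zi add1n addSn ltnS leq_add2l.
      by apply/leq_sum => j /negPf ji; rewrite ffunE ji.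
    exists f => // j; have := fA j; rewrite ffunE.
    by case: eqP => // ->; rewrite !inE => /andP[].
  by case: (hall_remove hA xy xi yi) => [/(rec x xi)|/(rec y yi)].
rewrite negb_exists => /forallP small.
have one i : exists x, A i == [set x].
  suff /cards1P[x ->] : #|A i| == 1 by exists x.
  rewrite eqn_leq [_ <= 1]leqNgt small/=.
  by have := hA [set i]; rewrite big_set1 cards1.
exists (fun i => xchoose (one i)) => [i j eij|i]; last first.
  by have /eqP{2}-> := xchooseP (one i); rewrite set11.
apply/eqP/negPn/negP => nij.
have := hA [set i; j]; rewrite cards2 nij finset.bigcup_setU !big_set1.
have /eqP-> := xchooseP (one i); have /eqP-> := xchooseP (one j).
by rewrite eij finset.setUid cards1.
Qed.

End Hall.

(** The Frobenius-Koenig form of Hall's theorem: a violating set [X], together with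
    enough points outside its neighbourhood, is an empty rectangle. Asking for
    [#|X| + #|Y|] to be exactly [#|T|.+1], not merely larger, keeps the number
    of rectangles in the union bound small. *)
Lemma perm_of_no_empty_rectangle (T : finType) (r : rel T) :
  (forall X Y : {set T}, (#|X| + #|Y|)%N = #|T|.+1 ->
     [exists x in X, exists y in Y, r x y]) ->
  exists s : {perm T}, forall x, r x (s x).
Proof.
move=> meet; pose A := [ffun x => [set y | r x y]].
have [|f finj fA] := @hall _ _ A; last first.
  by exists (perm finj) => x; have := fA x; rewrite permE ffunE inE.
move=> X; rewrite leqNgt; apply/negP => NX; set N := \bigcup_(i in X) A i in NX.
have : (0 < #|[set Y : {set T} | Y \subset ~: N & #|Y| == (#|T|.+1 - #|X|)%N]|)%N.
  rewrite cards_draws bin_gt0; have := cardsC N; have := max_card (mem X); lia.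
case/card_gt0P => Y; rewrite inE => /andP[YN /eqP cY].
have XY : (#|X| + #|Y|)%N = #|T|.+1 by rewrite cY subnKC// ltnW// ltnS max_card.
have /existsP[x /andP[xX /existsP[y /andP[yY rxy]]]] := meet X Y XY.
have := fintype.subsetP YN _ yY; rewrite inE => /negP; apply.
by apply/bigcupP; exists x => //; rewrite ffunE inE.
Qed.

(** * The union bound under a product distribution *)

(** The probabilistic method in weighted form. A random [f] has weight
    [\prod_i w (f i)], so its values are drawn independently from the distribution
    [w] on [P]; the bad event [b] says that all values of [f] on [D b] are
    [miss b], and by independence its weight is the product in the third
    hypothesis. If every [f] met some bad event, the total weight 1 would be at
    most the sum over the bad events. *)
Lemma exists_choice_avoiding (R : realFieldType) (I T B : finType) (P : pred T)
    (w : T -> R) (E : pred B) (D : B -> {set I}) (miss : B -> pred T) :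
  (forall t, P t -> 0 <= w t) -> \sum_(t | P t) w t = 1 ->
  \sum_(b | E b) \prod_(i in D b) (\sum_(t | P t && miss b t) w t) < 1 ->
  exists f : {ffun I -> T}, (forall i, P (f i)) /\
    forall b, E b -> exists2 i, i \in D b & ~~ miss b (f i).
Proof.
move=> w0 w1 lt1; apply: contrapT => nof; move: lt1; apply/negP; rewrite -leNgt.
have dist b : \prod_(i in D b) (\sum_(t | P t && miss b t) w t) =
    \sum_(f in ffun_on P)
       (\prod_i w (f i)) * ([forall (i | i \in D b), miss b (f i)])%:R.
  transitivity (\prod_(i : I) \sum_(t | P t)
      w t * ((i \in D b) ==> miss b t)%:R : R).
    rewrite big_mkcond; apply: eq_bigr => i _; case: ifP => _ /=.
      by rewrite big_mkcondr; apply: eq_bigr => t _; case: (miss b t); rewrite (mulr1, mulr0).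
    by under eq_bigr do rewrite mulr1.
  rewrite bigA_distr_big; apply: eq_bigr => f _; rewrite big_split/=; congr (_ * _).
  have [/forallP allm|/forallPn[i nm]] := boolP [forall (i | i \in D b), miss b (f i)].
    by rewrite big1// => i _; rewrite allm.
  by rewrite (bigD1 i)//= (negPf nm) mul0r.
under eq_bigr do rewrite dist.
rewrite exchange_big/=.
have total : \sum_(f in ffun_on P) \prod_(i : I) w (f i) = 1.
  by rewrite -(bigA_distr_big P (fun=> w))/= big1.
rewrite -[leLHS]total; apply: ler_sum => f /ffun_onP fP; rewrite -mulr_sumr. rewrite ler_peMr ?prodr_ge0//.
  by move=> i _; apply/w0/fP.
have [b Eb bad] : exists2 b, E b & [forall (i | i \in D b), miss b (f i)].
  apply: contrapT => nob; apply: nof; exists f; split=> [i|b Eb]; first exact: fP.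
  have /forallPn[i] : ~~ [forall (i | i \in D b), miss b (f i)].
    by apply/negP => bad; apply: nob; exists b.
  by rewrite negb_imply => /andP[iD nm]; exists i.
rewrite (bigD1 b)//= bad lerDl; apply: sumr_ge0 => b' _; exact: ler0n.
Qed.

(** * Counting the blocking rectangles *)

Lemma leq_bin_expn n m : ('C(n, m) <= n ^ m)%N.
Proof.
apply: (@leq_trans (n ^_ m)).
  by rewrite -bin_ffact leq_pmulr// fact_gt0.
elim: m => [|m IH]; first by rewrite ffactn0.
by rewrite ffactnSr expnSr leq_mul// leq_subr.
Qed.

(** Each rectangle shape contributes a geometrically small amount. For [t = 1]
    the factor [q ^+ k] is only [q^-1 <= 2] times [q ^+ k.+1]. For [t >= 2] it
    suffices that [u >= k.+1 / 2]: then [q ^+ (t * u)] is at most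
    [(q ^+ k.+1) ^ (t / 2)], the half-integral exponent being avoided by comparing
    squares, and the binomials are at most [k ^ (2 t - 1)]. *)
Lemma rectangle_term (R : realFieldType) (k : nat) (q : R) (t u : nat) :
  (0 < k)%N -> 1 <= 2 * q -> q <= 1 -> 4 * k%:R ^+ 4 * q ^+ k.+1 <= 1 ->
  (0 < t)%N -> (t <= u)%N -> (t + u)%N = k.+1 ->
  'C(k, t)%:R * 'C(k, u)%:R * q ^+ (t * u) <=
    4 * k%:R ^+ 3 * q ^+ k.+1 * 2^-1 ^+ t.
Proof.
move=> k0 q2 q1 kq.
have q0 : 0 <= q by lra.
have k1 : 1 <= k%:R :> R by rewrite ler1n.
case: t => [//|[|m]] _ tu tuk.
  have -> : u = k by lia.
  rewrite bin1 binn mul1n mulr1.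
  rewrite [leRHS](_ : _ = (k%:R * q ^+ k) * (2 * q * k%:R ^+ 2)); last first.
    by rewrite (exprS q); field.
  rewrite ler_peMr ?mulr_ge0 ?exprn_ge0// ?ler0n//.
  by apply: mulr_ege1 => //; exact: exprn_ege1.
have -> : u = (k - m.+1)%N by lia.
rewrite bin_sub; last by lia.
set K := k%:R in k1 kq *; set W := q ^+ k.+1 in kq *.
have W0 : 0 <= W by rewrite exprn_ge0.
have K0 : 0 <= K by exact: le_trans k1.
have Kn n : 0 <= K ^+ n by rewrite exprn_ge0.
have h0 n : 0 <= (2^-1 : R) ^+ n by rewrite exprn_ge0 ?invr_ge0.
have bK n : 'C(k, n)%:R <= K ^+ n by rewrite -natrX ler_nat leq_bin_expn.
have b0 n : 0 <= 'C(k, n)%:R :> R by rewrite ler0n.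
have lhs0 : 0 <= 'C(k, m.+2)%:R * 'C(k, m.+1)%:R * q ^+ (m.+2 * (k - m.+1)).
  by rewrite mulr_ge0 ?exprn_ge0// mulr_ge0.
have rhs0 : 0 <= 4 * K ^+ 3 * W * 2^-1 ^+ m.+2.
  by apply: mulr_ge0 (h0 _); rewrite !mulr_ge0.
rewrite -ler_sqr ?nnegrE//.
apply: (@le_trans _ _ ((K ^+ m.+2 * K ^+ m.+1) ^+ 2 * W ^+ m.+2)).
  rewrite exprMn; apply: ler_pM; [exact: sqr_ge0|exact: sqr_ge0| |].
    by apply: lerXn2r; rewrite ?nnegrE; [exact: mulr_ge0|exact: mulr_ge0|exact: ler_pM].
  by rewrite /W -!exprM ler_wiXn2l//; nia.
have -> : (K ^+ m.+2 * K ^+ m.+1) ^+ 2 * W ^+ m.+2 =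
    (K ^+ 6 * W ^+ 2) * (K ^+ 4 * W) ^+ m.
  rewrite [(_ * W) ^+ m]exprMn [_ ^+ 4 ^+ m]exprAC !(exprS _ m.+1) !(exprS _ m).
  by move: (K ^+ m) (W ^+ m) => P V; ring.
have -> : (4 * K ^+ 3 * W * 2^-1 ^+ m.+2) ^+ 2 =
    (K ^+ 6 * W ^+ 2) * (4^-1) ^+ m.
  have -> : 4^-1 = 2^-1 ^+ 2 :> R by field.
  rewrite [_ ^+ 2 ^+ m]exprAC !(exprS _ m.+1) !(exprS _ m).
  by move: (_ ^+ m) => P; field.
apply: ler_wpM2l; first by rewrite mulr_ge0 ?exprn_ge0.
have KW0 : 0 <= K ^+ 4 * W by rewrite mulr_ge0.
by apply: lerXn2r; rewrite ?nnegrE ?invr_ge0 ?ler0n// -[4^-1]mulr1 ler_pdivlMl ?ltr0n// mulrA.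
Qed.

Lemma geometric_half (R : realFieldType) m : \sum_(s < m) (2^-1 : R) ^+ s <= 2.
Proof.
suff : \sum_(s < m) (2^-1 : R) ^+ s = 2 - 2 * 2^-1 ^+ m.
  move=> ->; have : 0 <= (2^-1 : R) ^+ m by rewrite exprn_ge0//; lra.
  lra.
elim: m => [|m IH]; first by rewrite big_ord0 expr0; ring.
by rewrite big_ord_recr/= IH exprS; field.
Qed.

(** The shapes [(s, k.+1 - s)] are symmetric in the two sides, so [rectangle_term]
    bounds each one by its smaller side; summing both possibilities over all [s]
    gives two geometric series. *)
Lemma rectangle_sum (R : realFieldType) (k : nat) (q : R) :
  (0 < k)%N -> 1 <= 2 * q -> q <= 1 -> 4 * k%:R ^+ 4 * q ^+ k.+1 <= 1 ->
  \sum_(X : {set 'I_k}) \sum_(Y : {set 'I_k} | (#|X| + #|Y|)%N == k.+1)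
    q ^+ (#|X| * #|Y|) <= 16 * k%:R ^+ 3 * q ^+ k.+1.
Proof.
move=> k0 q2 q1 kq.
have q0 : 0 <= q by lra.
have cardX (X : {set 'I_k}) : (#|X| < k.+1)%N.
  by rewrite ltnS -[leqRHS]card_ord max_card.
have -> : \sum_(X : {set 'I_k}) \sum_(Y : {set 'I_k} | (#|X| + #|Y|)%N == k.+1)
    q ^+ (#|X| * #|Y|) =
    \sum_(s < k.+1) 'C(k, s)%:R * 'C(k, k.+1 - s)%:R * q ^+ (s * (k.+1 - s)).
  rewrite (partition_big (fun X => Ordinal (cardX X)) xpredT)//=.
  apply: eq_bigr => s _.
  rewrite (eq_bigr (fun=> 'C(k, k.+1 - s)%:R * q ^+ (s * (k.+1 - s)))).
    rewrite sumr_const -[LHS]mulr_natl mulrA; congr (_%:R * _ * _).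
    have := card_draws 'I_k s; rewrite card_ord => <-; apply: eq_card => X.
    by rewrite !inE.
  move=> X /eqP <- /=.
  rewrite (eq_bigr (fun=> q ^+ (#|X| * (k.+1 - #|X|)))).
    rewrite sumr_const -[LHS]mulr_natl; congr (_%:R * _).
    have := card_draws 'I_k (k.+1 - #|X|)%N; rewrite card_ord => <-.
    apply: eq_card => Y; rewrite !inE unfold_in -[RHS](eqn_add2l #|X|) subnKC//.
    exact: ltnW (cardX X).
  by move=> Y /eqP <-; rewrite addKn.
pose D := 4 * k%:R ^+ 3 * q ^+ k.+1.
have D0 : 0 <= D by rewrite !mulr_ge0 ?exprn_ge0 ?ler0n.
apply: (@le_trans _ _ (\sum_(s < k.+1) (D * 2^-1 ^+ s + D * 2^-1 ^+ (k - s)))).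
  apply: ler_sum => s _.
  have h0 m : 0 <= D * (2^-1) ^+ m by rewrite mulr_ge0 ?exprn_ge0//; lra.
  have [s0|s0] := posnP (s : nat).
    by rewrite s0 !subn0 (bin_small (ltnSn k)) mulr0 mul0r addr_ge0.
  have sk := ltn_ord s.
  have [le|lt] := leqP s (k.+1 - s)%N.
    apply: le_trans (rectangle_term k0 q2 q1 kq s0 le _) _; [lia|by rewrite lerDl].
  rewrite [X in X * _]mulrC mulnC.
  apply: le_trans (rectangle_term k0 q2 q1 kq _ (ltnW lt) _) _; [lia|lia|].
  rewrite -/D; apply: (@le_trans _ _ (D * 2^-1 ^+ (k - s))); last by rewrite lerDr.
  by rewrite ler_wpM2l// ler_wiXn2l ?invr_ge0 ?ler0n ?invf_le1 ?ltr0n ?ler1n//; lia.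
rewrite big_split/= -!mulr_sumr.
rewrite [X in _ + _ * X](reindex_inj rev_ord_inj)/=.
rewrite [X in _ + _ * X](eq_bigr (fun s : 'I_k.+1 => 2^-1 ^+ s)); last first.
  by move=> s _; rewrite subSS subKn// -ltnS.
by have := ler_wpM2l D0 (geometric_half R k.+1); rewrite /D; lra.
Qed.

(** * Packings from a fractional colouring *)

(** Colours are encoded as elements of a common ordinal ['I_N.+1], so that the
    random choices are indexed by a finite type; [col v] enumerates the list of
    [v]. A bad event is a vertex [v] with a rectangle [X * Y] of indices and list
    positions such that [v] is missed by all the corresponding sets. *)
Lemma list_packable_of_distr (R : realType) (G : sgraph) (p : {set G} -> R)
    (k : nat) (q : R) :
  indep_distr p -> (forall v, 1 - pr_mem p v <= q) ->
  (0 < k)%N -> 1 <= 2 * q -> q <= 1 ->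
  4 * k%:R ^+ 4 * q ^+ k.+1 <= 1 ->
  16 * #|G|%:R * k%:R ^+ 3 * q ^+ k.+1 < 1 ->
  list_packable G k.
Proof.
move=> [p0 p1] pq k0 q2 q1 kq nkq; split=> // L Lk.
pose col v (j : 'I_k) := nth 0%N (enum_fset (L v)) j.
have szL v : size (enum_fset (L v)) = k by rewrite -(Lk v).
have colL v j : col v j \in L v by apply: mem_nth; rewrite szL.
have col_inj v : injective (col v).
  move=> x y /eqP; rewrite nth_uniq ?szL ?fset_uniq// => /eqP; exact: val_inj.
pose N := (\max_v \max_j col v j)%N.
pose idx v j : 'I_N.+1 := inord (col v j).
have idxE v j : idx v j = col v j :> nat.
  rewrite inordK// ltnS; apply: leq_trans (leq_bigmax v); exact: leq_bigmax.
pose D (b : G * ({set 'I_k} * {set 'I_k})) : {set 'I_N.+1 * 'I_k} :=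
  [set (idx b.1 x.2, x.1) | x in finset.setX b.2.1 b.2.2].
pose E (b : G * ({set 'I_k} * {set 'I_k})) := (#|b.2.1| + #|b.2.2|)%N == k.+1.
have cD b : #|D b| = (#|b.2.1| * #|b.2.2|)%N.
  rewrite -cardsX; apply: card_imset => -[i j] [i' j'] /= [eij ->]; congr (_, _).
  by apply: (col_inj b.1); rewrite -!idxE eij.
have missE v : \sum_(S | independent S && (v \notin S)) p S = 1 - pr_mem p v.
  by rewrite -p1 [in RHS](bigID (fun S : {set G} => v \in S))/= /pr_mem addrAC subrr add0r.
have miss0 v : 0 <= \sum_(S | independent S && (v \notin S)) p S.
  by apply: sumr_ge0 => S /andP[/p0].
have [|f [find fmeet]] := @exists_choice_avoiding R ('I_N.+1 * 'I_k)%type {set G}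
    (G * ({set 'I_k} * {set 'I_k}))%type (@independent G) p E D
    (fun b S => b.1 \notin S) p0 p1.
  apply: le_lt_trans nkq.
  apply: (@le_trans _ _ (\sum_(b | E b) q ^+ (#|b.2.1| * #|b.2.2|))).
    apply: ler_sum => b _; rewrite prodr_const cD; apply: lerXn2r.
    - by rewrite nnegrE.
    - by rewrite nnegrE; apply: le_trans (miss0 b.1) _; rewrite missE.
    - by rewrite missE.
  rewrite -(pair_big_dep xpredT (fun _ (XY : {set 'I_k} * {set 'I_k}) =>
      (#|XY.1| + #|XY.2|)%N == k.+1) (fun _ XY => q ^+ (#|XY.1| * #|XY.2|)))/=.
  rewrite sumr_const -[leLHS]mulr_natl.
  have -> : 16 * #|G|%:R * k%:R ^+ 3 * q ^+ k.+1 =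
      #|G|%:R * (16 * k%:R ^+ 3 * q ^+ k.+1) by ring.
  apply: ler_wpM2l; first exact: ler0n.
  have := rectangle_sum k0 q2 q1 kq; apply: le_trans.
  by rewrite (pair_big_dep xpredT (fun X Y : {set 'I_k} => (#|X| + #|Y|)%N == k.+1)
    (fun X Y => q ^+ (#|X| * #|Y|))).
have perm v : exists s : {perm 'I_k}, forall i, v \in f (idx v (s i), i).
  apply: (@perm_of_no_empty_rectangle _ (fun i j => v \in f (idx v j, i))) => X Y.
  rewrite card_ord => XY; have [|z] := fmeet (v, (X, Y)); first by rewrite /E XY.
  case/imsetP => -[i j] /finset.setXP[/= iX jY] ->; rewrite negbK => vf.
  by apply/existsP; exists i; rewrite iX; apply/existsP; exists j; rewrite jY.
pose s v := sval (cid (perm v)); have sP v i : v \in f (idx v (s v i), i).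
  exact: (svalP (cid (perm v))).
exists (fun i v => col v (s v i)); split=> [i|i j ij v]; last by move/col_inj/perm_inj.
split=> [v|u v uv uvcol]; first exact: colL.
have idxuv : idx u (s u i) = idx v (s v i) by apply: val_inj; rewrite /= !idxE.
have /forall_inP/(_ u (sP u i))/forall_inP/(_ v) := find (idx u (s u i), i).
by rewrite idxuv sP uv => /(_ isT).
Qed.

(** * Basic bounds on the fractional chromatic number *)

Section FractionalChromaticNumber.
Variables (R : realType) (G : sgraph).
Hypothesis edgeG : has_edge G.

Definition frac_colourable (k : R) := 0 < k /\ exists p : {set G} -> R,
  indep_distr p /\ forall v : G, k^-1 <= pr_mem p v.

(** A uniformly random singleton contains each vertex with probability [1 / n]. *)
Lemma frac_colourable_order : frac_colourable #|G|%:R.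
Proof.
have [u [_ _]] := edgeG.
have n0 : 0 < #|G|%:R :> R by rewrite ltr0n; apply/card_gt0P; exists u.
have indep1 (v : G) : independent [set v]%SET.
  by apply/forall_inP => x /set1P->; apply/forall_inP => y /set1P->; rewrite edge_irr.
pose p (S : {set G}) : R := (#|S| == 1%N)%:R / #|G|%:R.
have p1 (S : {set G}) : #|S| == 1%N -> independent S by case/cards1P => x ->.
split=> //; exists p; split; first split=> [S _|].
- by rewrite mulr_ge0 ?invr_ge0 ?ler0n.
- rewrite -mulr_suml (bigID (fun S : {set G} => #|S| == 1%N))/= [X in _ + X]big1.
    rewrite (eq_bigl (fun S : {set G} => #|S| == 1%N)) => [|S]; last first.
      by apply: andb_idl; exact: p1.
    rewrite (eq_bigr (fun=> 1)) => [|S ->//].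
    rewrite addr0 sumr_const.
    have := card_draws G 1; rewrite bin1 cardsE => ->.
    by rewrite divff// lt0r_neq0.
  by move=> S /andP[_ /negPf ->].
- move=> v; rewrite /pr_mem (bigD1 [set v]%SET)/=; last by rewrite indep1 set11.
  rewrite /p cards1 eqxx mul1r lerDl; apply: sumr_ge0 => S _.
  by rewrite mulr_ge0 ?invr_ge0 ?ler0n.
Qed.

(** The two ends of an edge never lie in a common independent set, so the
    probabilities of covering them add up to at most 1. *)
Lemma frac_colourable_ge2 k : frac_colourable k -> 2 <= k.
Proof.
have [u [v uv]] := edgeG; move=> [k0 [p [[p0 p1] pk]]].
have : pr_mem p u + pr_mem p v <= 1.
  rewrite -p1 [leRHS](bigID (fun S : {set G} => u \in S))/= lerD2l.
  rewrite [leRHS]big_mkcond [leLHS]big_mkcond/=; apply: ler_sum => S _.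
  case: ifP => [/andP[iS vS]|_]; last by case: ifP => // /andP[/p0].
  rewrite iS; case: ifP => // /negbFE uS.
  by have /forall_inP/(_ u uS)/forall_inP/(_ v vS) := iS; rewrite uv.
have := pk u; have := pk v => hv hu huv.
have : k^-1 + k^-1 <= 1 by apply: le_trans huv; exact: lerD.
by rewrite -mulr2n -[_ *+ 2]mulr_natl ler_pdivrMr// mul1r.
Qed.

Let chif := frac_chromatic_number R G.

Lemma frac_chromatic_number_ge2 : 2 <= chif.
Proof.
apply: lb_le_inf; first by exists #|G|%:R; exact: frac_colourable_order.
exact: frac_colourable_ge2.
Qed.

Lemma frac_chromatic_number_le_order : chif <= #|G|%:R.
Proof.
apply: ge_inf; last exact: frac_colourable_order.
by exists 2; exact: frac_colourable_ge2.
Qed.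

(** Distributions of value arbitrarily close to the infimum, which is all that the
    strict inequalities of the union bound ask for. *)
Lemma frac_colourable_lt x : chif < x -> exists2 k, frac_colourable k & k < x.
Proof. by apply: inf_lt; exists #|G|%:R; exact: frac_colourable_order. Qed.

End FractionalChromaticNumber.

(** * Numerical estimates *)

Section Estimates.
Variable (R : realType).
Implicit Types (x : R).

Lemma ln_ratio_ge x : 1 < x -> x^-1 <= ln (x / (x - 1)).
Proof.
move=> x1; rewrite -[x / _]invrK invf_div.
have -> : (x - 1) / x = 1 + - x^-1 by field; lra.
rewrite lnV ?posrE; last by rewrite subr_gt0 invf_lt1//; lra.
by rewrite lerNr le_ln1Dx// ltrN2 invf_lt1//; lra.
Qed.

Lemma ln_ratio_le_ln2 x : 2 <= x -> ln (x / (x - 1)) <= ln 2.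
Proof.
by move=> x2; rewrite ler_ln ?posrE ?divr_gt0//; [rewrite ler_pdivrMr| |]; lra.
Qed.

Lemma exp_ge_pow5 x : 0 <= x -> x ^+ 5 / 120 <= expR x.
Proof.
by move=> x0; apply: le_trans (expR_ge1Dxn 4 x0); rewrite (_ : 5`!%:R = 120) ?lerDr.
Qed.

(** The factor [A * l] stands for the size of [k] up to powers of [n], with [l] the
    logarithm of [n]: a power of [n] beats the polylogarithmic terms. The
    threshold comes from [exp_ge_pow5], with [1920 = 16 * 120]. *)
Lemma eventually_pow4_expRN (A eta : R) : 0 < A -> 0 < eta ->
  exists2 l0, 0 < l0 & forall l, l0 < l ->
    1 <= A * l /\ 16 * (A * l) ^+ 4 * expR (- (eta * l)) < 1.
Proof.
move=> A0 eta0; pose l0 := A^-1 + 1920 * A ^+ 4 / eta ^+ 5.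
have A1 : 0 < A^-1 by rewrite invr_gt0.
have l1 : 0 < 1920 * A ^+ 4 / eta ^+ 5 by rewrite divr_gt0 ?mulr_gt0 ?exprn_gt0.
exists l0 => [|l lt_l]; first exact: addr_gt0.
have l_gt0 : 0 < l by apply: lt_trans lt_l; exact: addr_gt0.
split.
  by rewrite mulrC -ler_pdivrMr// div1r; apply: ltW; apply: lt_trans lt_l; rewrite ltrDl.
rewrite expRN ltr_pdivrMr ?expR_gt0// mul1r.
apply: lt_le_trans (exp_ge_pow5 _); last by apply: mulr_ge0; apply: ltW.
have : 1920 * A ^+ 4 < eta ^+ 5 * l.
  by rewrite [ltRHS]mulrC -ltr_pdivrMr ?exprn_gt0// (lt_trans _ lt_l)// ltrDr.
rewrite -(ltr_pM2r (exprn_gt0 4 l_gt0)) => h.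
suff -> : 16 * (A * l) ^+ 4 = 1920 * A ^+ 4 * l ^+ 4 / 120.
  have -> : (eta * l) ^+ 5 = eta ^+ 5 * l * l ^+ 4 by ring.
  by rewrite ltr_pM2r ?invr_gt0 ?ltr0n.
by field.
Qed.
End Estimates.

(** * Asymptotic bounds *)

(** [K] is an upper bound for the number [k] of colourings, [c] the leading
    constant and [c'] the exponent with which failure probabilities decay. The
    gap between [c'] and [c] pays for a distribution that only approaches the
    fractional chromatic number: the missing probability [q = (1 - 1 / chif) ^
    (c' / c)] is strictly larger than [1 - 1 / chif]. *)
Lemma list_packing_number_le (R : realType) (G : sgraph) (c c' K : R) :
  let chif := frac_chromatic_number R G in
  let n := #|G|%:R : R in
  let x := c * ln n / ln (chif / (chif - 1)) in
  has_edge G -> (2 <= #|G|)%N -> 1 <= c -> 0 < c' -> c' < c -> x <= K ->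
  16 * n * K ^+ 3 * expR (- (c' * ln n)) < 1 ->
  4 * K ^+ 4 * expR (- (c' * ln n)) <= 1 ->
  (list_packing_number G)%:R <= x.
Proof.
move=> chif n x edgeG n2 c1 c'0 c'c xK nK4 K4.
have chi2 : 2 <= chif by exact: frac_chromatic_number_ge2.
pose lam := ln (chif / (chif - 1)).
have lam0 : 0 < lam.
  by apply: lt_le_trans (ln_ratio_ge _); [rewrite invr_gt0|]; lra.
have n0 : 0 < n by rewrite ltr0n; lia.
have lln : lam <= ln n.
  apply: le_trans (ln_ratio_le_ln2 chi2) _.
  by rewrite ler_ln ?posrE// ler_nat.
have x1 : 1 <= x.
  rewrite ler_pdivlMr// mul1r; apply: (le_trans lln).
  by apply: ler_peMl => //; exact: le_trans (ltW lam0) lln.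
pose k := Num.truncn x.
have k0 : (0 < k)%N by rewrite truncn_gt0.
have x0 : 0 <= x by lra.
have kx : k%:R <= x by rewrite truncn_le.
have xk : x < k.+1%:R by have /andP[] := truncn_itv x0.
pose q := expR (- (lam * (c' / c))).
have lamc0 : 0 < lam * (c' / c) by rewrite mulr_gt0 ?divr_gt0//; lra.
have q0 : 0 <= q by exact: expR_ge0.
have q1 : q < 1 by rewrite expR_lt1 oppr_lt0.
have q2 : 1 <= 2 * q.
  rewrite -ler_pdivrMl// mulr1 -[2^-1]lnK ?posrE ?invr_gt0// ler_expR lnV ?posrE//.
  rewrite lerN2 (le_trans _ (ln_ratio_le_ln2 chi2))// ler_piMr ?(ltW lam0)//.
  by rewrite ler_pdivrMr; lra.
(* As [1 - 1 / chif = expR (- lam) < q], a fractional colouring close to the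
   infimum misses each vertex with probability at most [q]. *)
have chiq : chif < (1 - q)^-1.
  have -> : chif = (1 - expR (- lam))^-1.
    by rewrite expRN lnK ?posrE ?divr_gt0//; [field|..]; lra.
  rewrite ltf_pV2 ?posrE ?subr_gt0 ?expR_lt1 ?oppr_lt0//.
  by rewrite ltrD2l ltrN2 ltr_expR ltrN2 gtr_pMr// ltr_pdivrMr; lra.
have [m [m0 [p [distp pm]]] mq] := frac_colourable_lt edgeG chiq.
have W : q ^+ k.+1 <= expR (- (c' * ln n)).
  rewrite -expRM_natr ler_expR mulNr lerN2.
  have -> : c' * ln n = lam * (c' / c) * x.
    by rewrite /x -/lam; field; apply/andP; split; apply/lt0r_neq0 => //; lra.
  by rewrite ler_wpM2l ?(ltW xk)// mulr_ge0 ?divr_ge0//; lra.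
have kK : k%:R <= K by exact: le_trans xK.
have kKX i : k%:R ^+ i <= K ^+ i.
  by apply: lerXn2r; rewrite ?nnegrE ?ler0n// (le_trans _ kK).
have kKW i : k%:R ^+ i * q ^+ k.+1 <= K ^+ i * expR (- (c' * ln n)).
  by apply: ler_pM (kKX _) W; rewrite exprn_ge0.
have packk : list_packable G k.
  apply: (list_packable_of_distr distp (q := q)) => //; last 2 first.
  - by apply: le_trans K4; rewrite -mulrA -[leRHS]mulrA ler_wpM2l.
  - apply: le_lt_trans nK4; rewrite -mulrA -[leRHS]mulrA ler_wpM2l//.
    by rewrite mulr_ge0 ?ler0n.
  - move=> v; rewrite lerBlDl -lerBlDr; apply: le_trans (pm v).
    by rewrite -[leLHS]invrK lef_pV2 ?posrE ?invr_gt0 ?subr_gt0// ltW.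
  - exact: ltW.
apply: le_trans kx; rewrite ler_nat /list_packing_number.
by case: ex_minnP => m' _; apply; apply/asboolP.
Qed.

Lemma packing_bound_le (R : realType) (G : sgraph) (c : R) :
  let chif := frac_chromatic_number R G in
  let n := #|G|%:R : R in
  has_edge G -> (2 <= #|G|)%N -> 0 <= c ->
  c * ln n / ln (chif / (chif - 1)) <= c * chif * ln n.
Proof.
move=> chif n edgeG n2 c0.
have chi2 : 2 <= chif by exact: frac_chromatic_number_ge2.
have ln0 : 0 <= ln n by rewrite ln_ge0// ler1n; lia.
have inv_le : chif^-1 <= ln (chif / (chif - 1)) by apply: ln_ratio_ge; lra.
have chi0 : 0 < chif by lra.
have lam0 : 0 < ln (chif / (chif - 1)) by apply: lt_le_trans inv_le; rewrite invr_gt0.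
by rewrite mulrAC ler_wpM2r// ler_wpM2l// -[leRHS]invrK lef_pV2 ?posrE ?invr_gt0.
Qed.

Lemma ln_card_large (R : realType) (l0 : R) : exists n0 : nat,
  forall n : nat, (n0 <= n)%N -> (2 <= n)%N /\ l0 < ln n%:R.
Proof.
exists (Num.truncn (expR l0)).+2 => n len; split; first by lia.
have lt_n : expR l0 < n%:R.
  have /andP[_ lt] := truncn_itv (expR_ge0 l0).
  by apply: lt_le_trans lt _; rewrite ler_nat; lia.
by rewrite -[l0]expRK ltr_ln ?posrE ?expR_gt0// (lt_trans (expR_gt0 l0)).
Qed.

Theorem theorem5 (R : realType) :
  (forall eps : R, 0 < eps ->
     exists n0 : nat, forall G : sgraph,
       has_edge G -> (n0 <= #|G|)%N ->
       let chif := frac_chromatic_number R G in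
       let n := #|G|%:R : R in
       (list_packing_number G)%:R
         <= (5 + eps) * ln n / ln (chif / (chif - 1))
         <= (5 + eps) * chif * ln n)
  /\
  (forall M eps : R, 0 < eps ->
     exists n0 : nat, forall G : sgraph,
       has_edge G -> (n0 <= #|G|)%N ->
       let chif := frac_chromatic_number R G in
       let n := #|G|%:R : R in
       chif <= M ->
       (list_packing_number G)%:R
         <= (1 + eps) * ln n / ln (chif / (chif - 1))
         <= (1 + eps) * chif * ln n).
Proof.
split=> [eps eps0|M eps eps0].
- pose A := 5 + eps.
  have A0 : 0 < A by rewrite /A; lra.
  have [l0 l0_gt0 l0P] := eventually_pow4_expRN A0 (@ltr01 R).
  have [n0 n0P] := ln_card_large l0; exists n0 => G edgeG /n0P[n2 ltl] /=.
  set chif := frac_chromatic_number R G; set n := #|G|%:R : R.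
  have [Al1 small] := l0P _ ltl.
  have bound := packing_bound_le edgeG n2 (ltW A0); apply/andP; split; last exact: bound.
  have n_gt0 : 0 < n by rewrite ltr0n; lia.
  have ln0 : 0 < ln n by apply: lt_trans ltl.
  move: small; rewrite mul1r expRN lnK ?posrE// -/n => small.
  (* The bound [k <= A * n * ln n] costs a factor [n ^ 4] in [k ^ 4]; the decay
     [n ^ -5] leaves one negative power of [n], hence the exponent [eta = 1]. *)
  have e5 : expR (- (5 * ln n)) = n^-1 ^+ 5.
    by rewrite -mulrN expRM_natl expRN lnK ?posrE.
  apply: (@list_packing_number_le R G A 5 (n * (A * ln n))) => //.
  + by rewrite /A; lra.
  + by rewrite /A; lra.
  + apply: le_trans bound _.
    have -> : A * chif * ln n = chif * (A * ln n) by ring.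
    apply: ler_wpM2r; first by apply: mulr_ge0; exact: ltW.
    exact: frac_chromatic_number_le_order.
  + rewrite -/n e5 (_ : _ * _ = 16 * (A * ln n) ^+ 3 * n^-1); last first.
      by field; exact: lt0r_neq0.
    apply: le_lt_trans small; rewrite ler_wpM2r ?invr_ge0 ?(ltW n_gt0)//.
    by rewrite ler_wpM2l// ler_weXn2l.
  + rewrite -/n e5 (_ : _ * _ = 4 * (A * ln n) ^+ 4 * n^-1); last first.
      by field; exact: lt0r_neq0.
    apply: le_trans (ltW small); rewrite ler_wpM2r ?invr_ge0 ?(ltW n_gt0)//.
    by rewrite ler_wpM2r ?ler_nat// exprn_ge0// (le_trans ler01).
- pose c := 1 + eps; pose A := c * (`|M| + 1).
  have c0 : 0 < c by rewrite /c; lra.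
  have A0 : 0 < A by rewrite mulr_gt0// ltr_wpDl.
  have eps2 : 0 < eps / 2 by lra.
  have [l0 l0_gt0 l0P] := eventually_pow4_expRN A0 eps2.
  have [n0 n0P] := ln_card_large l0; exists n0 => G edgeG /n0P[n2 ltl] chif n chiM.
  have [Al1 small] := l0P _ ltl.
  have bound := packing_bound_le edgeG n2 (ltW c0); apply/andP; split; last exact: bound.
  have n_gt0 : 0 < n by rewrite ltr0n; lia.
  have n1 : 1 <= n by rewrite ler1n; lia.
  have ln0 : 0 < ln n by apply: lt_trans ltl.
  (* Here [k <= A * ln n], so [n ^ -1] only has to absorb the sum over the
     vertices, and [n ^ (- eps / 2)] beats the power of the logarithm. *)
  have e1 : expR (- ((1 + eps / 2) * ln n)) = n^-1 * expR (- (eps / 2 * ln n)).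
    by rewrite mulrDl mul1r opprD expRD (expRN (ln n)) lnK ?posrE.
  have E0 := expR_ge0 (- (eps / 2 * ln n)).
  apply: (@list_packing_number_le R G c (1 + eps / 2) (A * ln n)) => //.
  + by rewrite /c; lra.
  + lra.
  + by rewrite /c; lra.
  + apply: le_trans bound _; rewrite ler_wpM2r ?(ltW ln0)// ler_wpM2l ?(ltW c0)//.
    by apply: le_trans chiM _; have := ler_norm M; lra.
  + rewrite -/n e1; apply: le_lt_trans small.
    rewrite (_ : _ * _ = 16 * (A * ln n) ^+ 3 * expR (- (eps / 2 * ln n))); last first.
      by field; exact: lt0r_neq0.
    by rewrite ler_wpM2r// ler_wpM2l// ler_weXn2l.
  + rewrite -/n e1; apply: le_trans (ltW small); rewrite mulrA ler_wpM2r//.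
    apply: (@le_trans _ _ (4 * (A * ln n) ^+ 4)).
      rewrite ler_piMr ?invf_le1// mulr_ge0// exprn_ge0//.
      exact: le_trans ler01 Al1.
    by rewrite ler_wpM2r ?ler_nat// exprn_ge0// (le_trans ler01).
Qed.
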